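(* Let $\alpha\in\mathbb R$, let $\mathcal I\subset\mathbb R$ be a bounded open interval and let $\delta>0$. For any $r\in\mathbb N$ and any small $\varepsilon>0$, there exist two commuting diffeomorphisms $\mathcal F,\mathcal K\in\mathrm{Diff}_0^\infty(\mathbb T\times\mathbb R)$ such that $\mathcal F$ satisfies the intersection property and $$\|\mathcal F-\mathcal F_0\|_{C^r(\mathbb T\times\mathcal I_\delta)}<\varepsilon,\qquad \|\mathcal K-T_\alpha\|_{C^r(\mathbb T\times\mathcal I_\delta)}<\varepsilon,$$ but at least one of the maps $\mathcal F$ and $\mathcal K$ is non-integrable in $\mathbb T\times\mathcal I$.
   Context: $\mathbb T=\mathbb R/\mathbb Z$. $\mathrm{Diff}_0^\infty(\mathbb T\times\mathbb R)$ is the set of $C^\infty$ diffeomorphisms of $\mathbb T\times\mathbb R$ homotopic to the identity. $\mathcal F_0(x,y)=(x+\omega(y),y)$, where $\omega:\mathbb R\to\mathbb R$ is a fixed smooth diffeomorphism of $\mathbb R$, and $T_\alpha(x,y)=(x+\alpha,y)$. $\mathcal I_\delta=\{y\in\mathbb R:\mathrm{dist}(y,\mathcal I)<\delta\}$. The $C^r$ norm is the maximum of the sup norms of all partial derivatives of order at most $r$ of all components. A map $F$ of $\mathbb T\times\mathbb R$ satisfies the intersection property if each homotopically nontrivial circle $C^1$-close to $\{y=\mathrm{const}\}$ intersects its image under $F$. A map is called integrable in a region if (like $\mathcal F_0$ and $T_\alpha$) the region is completely foliated by smooth, homotopically nontrivial invariant circles of the map on which its dynamics is conjugate to a rigid rotation;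 otherwise it is non-integrable there. *)

(* Defs.v *)
(* Stdlib reals with Coquelicot.

   The cylinder T x R is the plane R * R modulo horizontal integer
   translations.  Its points are represented by points of the plane, its maps
   and curves by their lifts to the plane, and equality on the cylinder is
   [eqcyl].  Continuous maps from a simply connected space to the cylinder lift
   to the plane, so every continuous (smooth) map, curve or homotopy on the
   cylinder is represented by a continuous (smooth) one here. *)
From Stdlib Require Import Reals ZArith List.
From Coquelicot Require Import Coquelicot.
Open Scope R_scope.

Definition eqT (s t : R) : Prop := exists k : Z, s = t + IZR k.

Definition eqcyl (p q : R * R) : Prop := eqT (fst p) (fst q) /\ snd p = snd q.

Definition cyl_map (F : R * R -> R * R) : Prop :=
  forall p q, eqcyl p q -> eqcyl (F p) (F q).

Definition commuting (F K : R * R -> R * R) : Prop :=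
  forall p, eqcyl (F (K p)) (K (F p)).

Inductive axis : Set := xaxis | yaxis.

(* The restriction of [f] to the line through [p] parallel to the axis [a],
   and the abscissa of [p] on it. *)
Definition slice (a : axis) (f : R * R -> R) (p : R * R) : R -> R :=
  match a with
  | xaxis => fun s => f (s, snd p)
  | yaxis => fun s => f (fst p, s)
  end.

Definition coord (a : axis) (p : R * R) : R :=
  match a with xaxis => fst p | yaxis => snd p end.

Fixpoint pderiv (w : list axis) (f : R * R -> R) : R * R -> R :=
  match w with
  | nil => f
  | a :: w' => fun p => Derive (slice a (pderiv w' f) p) (coord a p)
  end.

Definition smooth1 (f : R -> R) : Prop := forall n t, ex_derive_n f n t.

Definition smooth2 (f : R * R -> R) : Prop :=
  forall (w : list axis) (p : R * R),
    continuous (pderiv w f) p /\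
    forall a : axis, ex_derive (slice a (pderiv w f) p) (coord a p).

Definition smooth_map (F : R * R -> R * R) : Prop :=
  smooth2 (fun p => fst (F p)) /\ smooth2 (fun p => snd (F p)).

Definition smooth_diffeo_R (f : R -> R) : Prop :=
  smooth1 f /\
  exists g : R -> R,
    smooth1 g /\ (forall t, g (f t) = t) /\ (forall t, f (g t) = t).

Definition smooth_diffeo_cyl (F : R * R -> R * R) : Prop :=
  cyl_map F /\ smooth_map F /\
  exists G : R * R -> R * R,
    cyl_map G /\ smooth_map G /\
    (forall p, eqcyl (G (F p)) p) /\ (forall p, eqcyl (F (G p)) p).

(* A homotopy with parameter in [0, 1] extends to all parameters in R by
   clamping, whence the requirement of continuity everywhere. *)
Definition homotopic_to_id (F : R * R -> R * R) : Prop :=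
  exists H : R * (R * R) -> R * R,
    (forall z, continuous H z) /\
    (forall s, 0 <= s <= 1 -> cyl_map (fun p => H (s, p))) /\
    (forall p, eqcyl (H (0, p)) (F p)) /\
    (forall p, eqcyl (H (1, p)) p).

Definition Diff0 (F : R * R -> R * R) : Prop :=
  smooth_diffeo_cyl F /\ homotopic_to_id F.

Definition F0 (omega : R -> R) (p : R * R) : R * R :=
  (fst p + omega (snd p), snd p).

Definition Talpha (alpha : R) (p : R * R) : R * R := (fst p + alpha, snd p).

Definition dist_set (y : R) (I : R -> Prop) : Rbar :=
  Glb_Rbar (fun d => exists z, I z /\ d = Rabs (y - z)).

Definition nbhd_set (I : R -> Prop) (delta : R) (y : R) : Prop :=
  Rbar_lt (dist_set y I) delta.

(* T x I, as a set of representatives *)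
Definition strip (I : R -> Prop) (p : R * R) : Prop := I (snd p).

Definition diff_map (F G : R * R -> R * R) (p : R * R) : R * R :=
  (fst (F p) - fst (G p), snd (F p) - snd (G p)).

(* The supremum, possibly infinite, of the absolute values on [A] of all partial
   derivatives of order at most [r] of both components of [F]. *)
Definition Cr_norm (r : nat) (A : R * R -> Prop) (F : R * R -> R * R) : Rbar :=
  Lub_Rbar (fun v => exists (w : list axis) (p : R * R),
    (length w <= r)%nat /\ A p /\
    (v = Rabs (pderiv w (fun q => fst (F q)) p) \/
     v = Rabs (pderiv w (fun q => snd (F q)) p))).

Definition closed_curve (gamma : R -> R * R) : Prop :=
  forall t, eqcyl (gamma (t + 1)) (gamma t).

(* injective as a map from T to the cylinder *)
Definition simple_curve (gamma : R -> R * R) : Prop :=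
  forall s t, eqcyl (gamma s) (gamma t) -> eqT s t.

Definition C1_curve (gamma : R -> R * R) : Prop :=
  forall t,
    ex_derive (fun s => fst (gamma s)) t /\
    ex_derive (fun s => snd (gamma s)) t /\
    continuous (Derive (fun s => fst (gamma s))) t /\
    continuous (Derive (fun s => snd (gamma s))) t.

Definition smooth_curve (gamma : R -> R * R) : Prop :=
  smooth1 (fun s => fst (gamma s)) /\ smooth1 (fun s => snd (gamma s)).

Definition regular_curve (gamma : R -> R * R) : Prop :=
  forall t, Derive (fun s => fst (gamma s)) t <> 0 \/
            Derive (fun s => snd (gamma s)) t <> 0.

(* free homotopy, on the cylinder, to a constant loop *)
Definition null_homotopic (gamma : R -> R * R) : Prop :=
  exists H : R * R -> R * R,
    (forall z, continuous H z) /\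
    (forall s, 0 <= s <= 1 -> closed_curve (fun t => H (s, t))) /\
    (forall t, eqcyl (H (0, t)) (gamma t)) /\
    (exists c, forall t, eqcyl (H (1, t)) c).

(* C^1-embedded circles *)
Definition C1_circle (gamma : R -> R * R) : Prop :=
  closed_curve gamma /\ simple_curve gamma /\
  C1_curve gamma /\ regular_curve gamma.

Definition smooth_circle (gamma : R -> R * R) : Prop :=
  closed_curve gamma /\ simple_curve gamma /\
  smooth_curve gamma /\ regular_curve gamma.

Definition C1_close (eta : R) (gamma : R -> R * R) (c : R) : Prop :=
  forall t,
    Rabs (fst (gamma t) - t) < eta /\
    Rabs (snd (gamma t) - c) < eta /\
    Rabs (Derive (fun s => fst (gamma s)) t - 1) < eta /\
    Rabs (Derive (fun s => snd (gamma s)) t) < eta.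

(* The closeness threshold [eta] may depend on [F] but not on the horizontal
   circle {y = c}. *)
Definition intersection_property (F : R * R -> R * R) : Prop :=
  exists eta : R, 0 < eta /\
    forall (gamma : R -> R * R) (c : R),
      C1_circle gamma -> ~ null_homotopic gamma -> C1_close eta gamma c ->
      exists s t, eqcyl (F (gamma s)) (gamma t).

(* [L] is the image in the cylinder of [gamma] (as a set of representatives). *)
Definition is_image (gamma : R -> R * R) (L : R * R -> Prop) : Prop :=
  forall p, L p <-> exists t, eqcyl (gamma t) p.

Definition smooth_essential_circle (L : R * R -> Prop) : Prop :=
  exists gamma : R -> R * R,
    smooth_circle gamma /\ ~ null_homotopic gamma /\ is_image gamma L.

Definition invariant (F : R * R -> R * R) (L : R * R -> Prop) : Prop :=
  forall q, L q <-> exists p, L p /\ eqcyl (F p) q.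

(* [phi] induces a homeomorphism from T onto [L] (a continuous bijection
   between compact Hausdorff spaces) conjugating the rotation by [rho] to the
   restriction of [F]. *)
Definition conj_rotation (F : R * R -> R * R) (L : R * R -> Prop) : Prop :=
  exists (phi : R -> R * R) (rho : R),
    (forall t, continuous phi t) /\
    closed_curve phi /\ simple_curve phi /\ is_image phi L /\
    (forall t, eqcyl (F (phi t)) (phi (t + rho))).

(* [U] is the disjoint union of the leaves.  No foliation charts are required:
   a decomposition of an open set of the cylinder into essential circles is
   automatically a topological foliation. *)
Definition foliates (leaf : (R * R -> Prop) -> Prop) (U : R * R -> Prop)
  : Prop :=
  (forall p, U p <-> exists L, leaf L /\ L p) /\
  (forall L L' p, leaf L -> leaf L' -> L p -> L' p -> forall q, L q <-> L' q).

(* Every point of [A] lies on a leaf of the foliation; leaves meeting [A] may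
   leave [A].  Requiring [U = A] would make the mere failure of [A] to be exactly
   invariant count as non-integrability. *)
Definition integrable_in (F : R * R -> R * R) (A : R * R -> Prop) : Prop :=
  exists (U : R * R -> Prop) (leaf : (R * R -> Prop) -> Prop),
    open U /\ (forall p, A p -> U p) /\ foliates leaf U /\
    forall L, leaf L ->
      smooth_essential_circle L /\ invariant F L /\ conj_rotation F L.

(* Main.v *)
Require Import Defs.
From Stdlib Require Import Reals.
From Coquelicot Require Import Coquelicot.
From Stdlib Require Import ZArith List Lia Lra FunctionalExtensionality.
Open Scope R_scope.

(** The perturbation preserves every horizontal circle and destroys the rigid
    rotation on some of them.  For a large integer [q], replace [alpha] by a
    nearby fraction [l / q], let [K] be the translation by it, and let
    [F (x, y) = (g x + omega y, y)] with [g x = x + k sin (2 pi q x)].  Since [g]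
    commutes with the translation by [1 / q], the maps [F] and [K] commute.  The
    difference with the unperturbed maps is [k sin (2 pi q x)] or a constant, all
    of whose derivatives up to order [r] are as small as desired
    ([Cr_norm_sine]).  The map [g] is a diffeomorphism when [2 pi q k < 1], and
    so is [F] ([Diff0_sheared]); the smoothness of the inverse comes from the
    formula [v' = 1 / (g' o v)] ([class_C_inverse]).

    A circle close to a horizontal one is a graph over the base.  Its highest
    point is mapped on or above the graph and its lowest point on or below it,
    because heights are preserved; by connectedness the image meets the circle
    ([intersection_of_height_preserving]).

    For [q] large there is a height [y0] in the strip with [omega y0 = m / q].
    There [F] acts as [g] followed by the translation by [m / q], so up to that
    translation, which [q] iterations make trivial, the orbit of the point
    [(1 / (4 q), y0)] is pushed by [g] monotonically towards the fixed point
    [1 / (2 q)] of [g] and never comes back close to its origin.  Under a rigid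
    rotation every point is recurrent ([rotation_recurrent]); so the point lies
    on no leaf on which [F] is conjugate to a rotation
    ([sheared_not_integrable]). *)

(** * Smooth functions of one variable *)

Lemma continuous_of_ex_derive (f : R -> R) (t : R) : ex_derive f t -> continuous f t.
Proof. exact (ex_derive_continuous f t). Qed.

Lemma slice_coord (a : axis) (f : R * R -> R) (p : R * R) :
  slice a f p (coord a p) = f p.
Proof. destruct a, p; reflexivity. Qed.

Lemma smooth1_const (k : R) : smooth1 (fun _ => k).
Proof. intros n t; apply ex_derive_n_const. Qed.

Lemma smooth1_id : smooth1 (fun t => t).
Proof.
  assert (H : forall n t, Derive_n (fun t => t) (S n) t = match n with O => 1 | _ => 0 end).
  { induction n as [|n IH]; intros t; [apply Derive_id|].
    change (Derive (Derive_n (fun t => t) (S n)) t = 0).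
    rewrite (Derive_ext _ _ _ IH). apply Derive_const. }
  intros [|[|n]] t; [exact I | apply ex_derive_id |].
  apply ex_derive_ext with (fun _ => match n with O => 1 | _ => 0 end).
  - intros s; now rewrite H.
  - apply ex_derive_const.
Qed.

Lemma smooth1_plus (f g : R -> R) :
  smooth1 f -> smooth1 g -> smooth1 (fun t => f t + g t).
Proof.
  intros Hf Hg n t.
  apply ex_derive_n_plus; apply filter_forall; intros; auto.
Qed.

Lemma smooth1_ex_derive (f : R -> R) (t : R) : smooth1 f -> ex_derive f t.
Proof. intros Hf; exact (Hf 1%nat t). Qed.

Lemma smooth1_Derive (f : R -> R) : smooth1 f -> smooth1 (Derive f).
Proof.
  intros Hf [|n] t; [exact I|].
  simpl. apply ex_derive_ext with (Derive_n f (S n)).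
  - intros s. replace (S n) with (n + 1)%nat by lia.
    symmetry; exact (Derive_n_comp f n 1 s).
  - exact (Hf (S (S n)) t).
Qed.

Lemma smooth1_continuous (f : R -> R) (t : R) : smooth1 f -> continuous f t.
Proof. intros Hf; exact (continuous_of_ex_derive f t (smooth1_ex_derive f t Hf)). Qed.

(** Keeping the phase [th] as a parameter makes sine waves stable under
    differentiation, which only shifts the phase by a quarter of a period and
    scales the amplitude. *)
Lemma is_derive_sine (k c th t : R) :
  is_derive (fun s => k * sin (c * s + th)) t (k * c * sin (c * t + (th + PI / 2))).
Proof.
  replace (sin (c * t + (th + PI / 2))) with (cos (c * t + th))
    by (rewrite cos_sin; f_equal; ring).
  auto_derive; [exact I | ring].
Qed.

Lemma smooth1_sine (k c th : R) : smooth1 (fun t => k * sin (c * t + th)).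
Proof.
  assert (H : forall n, exists k' th', forall t,
    Derive_n (fun s => k * sin (c * s + th)) n t = k' * sin (c * t + th')).
  { induction n as [|n (k' & th' & IH)].
    - now exists k, th.
    - exists (k' * c), (th' + PI / 2); intros t; simpl.
      rewrite (Derive_ext _ _ _ IH). apply is_derive_unique, is_derive_sine. }
  intros [|n] t; [exact I|]. simpl.
  destruct (H n) as (k' & th' & Hn).
  apply ex_derive_ext with (fun s => k' * sin (c * s + th')).
  - intros s; now rewrite Hn.
  - eexists; apply is_derive_sine.
Qed.

(** * Smooth functions on the plane *)

Definition partial (a : axis) (f : R * R -> R) (p : R * R) : R :=
  Derive (slice a f p) (coord a p).

Definition differentiable_along_axes (f : R * R -> R) : Prop :=
  forall a p, ex_derive (slice a f p) (coord a p).

(** Here the partial derivative taken first is peeled off first, whereas [pderiv]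
    peels off the one taken last: the derivative of a sum, a product or a
    composite is an explicit expression to which an induction on [n] applies. *)
Fixpoint class_C (n : nat) (f : R * R -> R) : Prop :=
  (forall p, continuous f p) /\
  match n with
  | O => True
  | S m => differentiable_along_axes f /\ forall a, class_C m (partial a f)
  end.

Lemma class_C_continuous (n : nat) (f : R * R -> R) :
  class_C n f -> forall p, continuous f p.
Proof. destruct n; intros [H _]; exact H. Qed.

Lemma class_C_pred (n : nat) : forall f, class_C (S n) f -> class_C n f.
Proof.
  induction n as [|n IH]; intros f (Hc & Hd & H).
  - now split.
  - split; [exact Hc|]. split; [exact Hd|]. intros a; apply IH, H.
Qed.

Lemma smooth2_of_class_C (f : R * R -> R) : (forall n, class_C n f) -> smooth2 f.
Proof.
  intros Hf.
  assert (H : forall w n, class_C n (pderiv w f)).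
  { induction w as [|a w IH]; intros n; [apply Hf|].
    destruct (IH (S n)) as (_ & _ & H). exact (H a). }
  intros w p; split.
  - exact (class_C_continuous 0 _ (H w O) p).
  - intros a. destruct (H w 1%nat) as (_ & Hd & _). apply Hd.
Qed.

Lemma class_C_const (k : R) (n : nat) : class_C n (fun _ => k).
Proof.
  revert k; induction n as [|n IH]; intros k.
  - split; [intros; apply continuous_const | exact I].
  - split; [intros; apply continuous_const|]. split.
    + intros [] p; apply ex_derive_const.
    + intros a. replace (partial a (fun _ => k)) with (fun _ : R * R => 0); [apply IH|].
      apply functional_extensionality; intros p.
      destruct a; symmetry; apply (Derive_const k).
Qed.

Lemma class_C_fst (n : nat) : class_C n fst.
Proof.
  destruct n as [|n].
  - split; [intros []; apply continuous_fst | exact I].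
  - split; [intros []; apply continuous_fst|]. split.
    + intros [] p; [apply ex_derive_id | apply ex_derive_const].
    + intros [].
      * replace (partial xaxis fst) with (fun _ : R * R => 1); [apply class_C_const|].
        apply functional_extensionality; intros p; symmetry; apply Derive_id.
      * replace (partial yaxis fst) with (fun _ : R * R => 0); [apply class_C_const|].
        apply functional_extensionality; intros p; symmetry; apply (Derive_const (fst p)).
Qed.

Lemma class_C_snd (n : nat) : class_C n snd.
Proof.
  destruct n as [|n].
  - split; [intros []; apply continuous_snd | exact I].
  - split; [intros []; apply continuous_snd|]. split.
    + intros [] p; [apply ex_derive_const | apply ex_derive_id].
    + intros [].
      * replace (partial xaxis snd) with (fun _ : R * R => 0); [apply class_C_const|].
        apply functional_extensionality; intros p; symmetry; apply (Derive_const (snd p)).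
      * replace (partial yaxis snd) with (fun _ : R * R => 1); [apply class_C_const|].
        apply functional_extensionality; intros p; symmetry; apply Derive_id.
Qed.

Lemma class_C_plus (n : nat) : forall f g,
  class_C n f -> class_C n g -> class_C n (fun p => f p + g p).
Proof.
  assert (Hc : forall f g : R * R -> R, (forall p, continuous f p) ->
    (forall p, continuous g p) -> forall p, continuous (fun p => f p + g p) p)
    by (intros; now apply (continuous_plus (V := R_NormedModule))).
  induction n as [|n IH]; intros f g (Hf & Hf') (Hg & Hg').
  - split; [now apply Hc | exact I].
  - destruct Hf' as [Df Pf], Hg' as [Dg Pg].
    split; [now apply Hc|]. split.
    + intros a p. generalize (Df a p) (Dg a p).
      destruct a; apply (ex_derive_plus (V := R_NormedModule)).
    + intros a.
      replace (partial a (fun p => f p + g p))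
        with (fun p => partial a f p + partial a g p); [now apply IH|].
      apply functional_extensionality; intros p. symmetry. unfold partial.
      generalize (Df a p) (Dg a p). destruct a; apply Derive_plus.
Qed.

Lemma class_C_mult (n : nat) : forall f g,
  class_C n f -> class_C n g -> class_C n (fun p => f p * g p).
Proof.
  assert (Hc : forall f g : R * R -> R, (forall p, continuous f p) ->
    (forall p, continuous g p) -> forall p, continuous (fun p => f p * g p) p)
    by (intros; now apply (continuous_mult (K := R_AbsRing))).
  induction n as [|n IH]; intros f g Hf Hg.
  - split; [|exact I]. apply Hc; eapply class_C_continuous; eassumption.
  - split; [apply Hc; eapply class_C_continuous; eassumption|].
    pose proof (class_C_pred _ _ Hf) as Hfn. pose proof (class_C_pred _ _ Hg) as Hgn.
    destruct Hf as (_ & Df & Pf), Hg as (_ & Dg & Pg).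
    split.
    + intros a p. generalize (Df a p) (Dg a p). destruct a; apply ex_derive_mult.
    + intros a.
      replace (partial a (fun p => f p * g p))
        with (fun p => partial a f p * g p + f p * partial a g p).
      { apply class_C_plus; apply IH; auto. }
      apply functional_extensionality; intros p. symmetry. unfold partial.
      rewrite <- (slice_coord a f p), <- (slice_coord a g p).
      generalize (Df a p) (Dg a p). destruct a; apply Derive_mult.
Qed.

Lemma class_C_inv (n : nat) : forall f,
  (forall p, f p <> 0) -> class_C n f -> class_C n (fun p => / f p).
Proof.
  induction n as [|n IH]; intros f H0 Hf.
  - split; [|exact I]. intros p.
    apply (continuous_comp f Rinv); [now apply (class_C_continuous 0) | now apply continuous_Rinv].
  - split.
    { intros p. apply (continuous_comp f Rinv);
        [now apply (class_C_continuous (S n)) | now apply continuous_Rinv]. }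
    pose proof (IH f H0 (class_C_pred _ _ Hf)) as Hi.
    destruct Hf as (_ & Df & Pf).
    assert (H0' : forall a p, slice a f p (coord a p) <> 0)
      by (intros a p; rewrite slice_coord; apply H0).
    split.
    + intros a p. generalize (Df a p) (H0' a p).
      destruct a; exact (ex_derive_inv _ _).
    + intros a.
      replace (partial a (fun p => / f p))
        with (fun p => (-1) * partial a f p * (/ f p * / f p)).
      { repeat apply class_C_mult; auto using class_C_const. }
      apply functional_extensionality; intros p. symmetry. unfold partial.
      transitivity (- Derive (slice a f p) (coord a p) / slice a f p (coord a p) ^ 2).
      * generalize (Df a p) (H0' a p). destruct a; exact (Derive_inv _ _).
      * rewrite slice_coord. field. apply H0.
Qed.

Lemma class_C_comp (n : nat) : forall phi f,
  smooth1 phi -> class_C n f -> class_C n (fun p => phi (f p)).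
Proof.
  induction n as [|n IH]; intros phi f Hphi Hf.
  - split; [|exact I]. intros p. apply (continuous_comp f phi);
      [now apply (class_C_continuous 0) | now apply smooth1_continuous].
  - split.
    { intros p. apply (continuous_comp f phi);
        [now apply (class_C_continuous (S n)) | now apply smooth1_continuous]. }
    pose proof (class_C_pred _ _ Hf) as Hfn.
    destruct Hf as (_ & Df & Pf).
    assert (Dphi : forall s, ex_derive phi s) by (intros; now apply smooth1_ex_derive).
    split.
    + intros a p. generalize (Df a p) (Dphi (slice a f p (coord a p))).
      intros H1 H2. destruct a; exact (ex_derive_comp _ _ _ H2 H1).
    + intros a.
      replace (partial a (fun p => phi (f p)))
        with (fun p => partial a f p * Derive phi (f p)).
      { apply class_C_mult; [apply Pf|]. apply IH; [now apply smooth1_Derive | exact Hfn]. }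
      apply functional_extensionality; intros p. symmetry. unfold partial.
      rewrite <- (slice_coord a f p).
      generalize (Df a p) (Dphi (slice a f p (coord a p))).
      intros H1 H2. destruct a; exact (Derive_comp _ _ _ H2 H1).
Qed.

(** * Inverses of expanding maps *)

Lemma derive_lower_bound (u : R -> R) (m s t : R) :
  (forall x, ex_derive u x) -> (forall x, m <= Derive u x) ->
  s <= t -> m * (t - s) <= u t - u s.
Proof.
  intros Hd Hm Hst.
  destruct (MVT_gen u s t (Derive u)) as (x & _ & ->).
  - intros; now apply Derive_correct.
  - intros. apply continuity_pt_filterlim, continuous_of_ex_derive, Hd.
  - apply Rmult_le_compat_r; [lra | apply Hm].
Qed.

Lemma derive_lower_bound_abs (u : R -> R) (m s t : R) :
  (forall x, ex_derive u x) -> (forall x, m <= Derive u x) ->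
  m * Rabs (t - s) <= Rabs (u t - u s).
Proof.
  intros Hd Hm. destruct (Rle_dec s t) as [H|H].
  - rewrite (Rabs_pos_eq (t - s)) by lra.
    eapply Rle_trans; [now apply (derive_lower_bound u) | apply Rle_abs].
  - rewrite (Rabs_minus_sym t s), (Rabs_minus_sym (u t)), (Rabs_pos_eq (s - t)) by lra.
    eapply Rle_trans; [apply (derive_lower_bound u); auto; lra | apply Rle_abs].
Qed.

(** The lower bound on the derivative yields surjectivity, by the intermediate
    value theorem, and makes the inverse Lipschitz with constant [1 / m].  Hence
    the increment [k] of the inverse tends to [0] with the increment [h] of the
    variable, and [k / h] is the inverse of a difference quotient of [u]. *)
Lemma expanding_inverse (u : R -> R) (m : R) :
  0 < m -> (forall x, ex_derive u x) -> (forall x, m <= Derive u x) ->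
  exists v : R -> R,
    (forall x, u (v x) = x) /\ (forall x, v (u x) = x) /\
    (forall x, is_derive v x (/ Derive u (v x))).
Proof.
  intros Hm Hd Hu.
  assert (Hc : continuity u)
    by (intros x; apply continuity_pt_filterlim, continuous_of_ex_derive, Hd).
  assert (Hs : forall x, {t | u t = x}).
  { intros x.
    (* An expanding map moves by at least [m d = |x - u 0|] between [0] and
       [d] or [- d]. *)
    set (d := Rabs (x - u 0) / m).
    assert (Hdm : m * d = Rabs (x - u 0)) by (unfold d; field; lra).
    assert (Hd0 : 0 <= d)
      by (apply Rmult_le_pos; [apply Rabs_pos | left; now apply Rinv_0_lt_compat]).
    pose proof (derive_lower_bound u m 0 d Hd Hu Hd0) as H1.
    pose proof (derive_lower_bound u m (- d) 0 Hd Hu ltac:(lra)) as H2.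
    pose proof (Rle_abs (x - u 0)). pose proof (Rabs_maj2 (x - u 0)).
    destruct (IVT_gen u (- d) d x Hc) as (t & _ & Ht); [|now exists t].
    rewrite Rmin_left, Rmax_right by lra. lra. }
  set (v := fun x => proj1_sig (Hs x)).
  assert (Huv : forall x, u (v x) = x) by (intros x; exact (proj2_sig (Hs x))).
  exists v. split; [exact Huv|].
  assert (Hlip : forall x y, m * Rabs (v x - v y) <= Rabs (x - y)).
  { intros x y. rewrite <- (Huv x) at 2. rewrite <- (Huv y) at 2.
    now apply derive_lower_bound_abs. }
  split.
  { intros x. pose proof (derive_lower_bound_abs u m x (v (u x)) Hd Hu) as H.
    rewrite Huv, Rminus_diag, Rabs_R0 in H.
    pose proof (Rabs_pos (v (u x) - x)).
    assert (Rabs (v (u x) - x) = 0) by nra.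
    destruct (Req_dec (v (u x) - x) 0) as [E|E]; [lra|].
    now apply Rabs_no_R0 in E. }
  intros x. apply is_derive_Reals. intros eps Heps.
  pose proof (proj1 (is_derive_Reals _ _ _) (Derive_correct _ _ (Hd (v x)))) as HD.
  set (d := Derive u (v x)) in *.
  assert (Hdm : m <= d) by apply Hu.
  assert (Hem : 0 < eps * (m * m)) by (repeat apply Rmult_lt_0_compat; lra).
  destruct (HD _ Hem) as [del Hdel].
  assert (Hpos : 0 < m * del) by (apply Rmult_lt_0_compat; [lra | apply cond_pos]).
  exists (mkposreal _ Hpos). intros h Hh Hlt. simpl in Hlt.
  set (k := v (x + h) - v x).
  assert (Huk : u (v x + k) - u (v x) = h).
  { unfold k. replace (v x + (v (x + h) - v x)) with (v (x + h)) by ring.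
    rewrite !Huv. ring. }
  assert (Hk0 : k <> 0) by (intros E; rewrite E, Rplus_0_r in Huk; lra).
  assert (Hkd : Rabs k < del).
  { pose proof (Hlip (x + h) x) as H. replace (x + h - x) with h in H by ring.
    fold k in H. apply Rmult_lt_reg_l with m; lra. }
  specialize (Hdel k Hk0 Hkd). rewrite Huk in Hdel.
  assert (Hslope : m <= Rabs (h / k)).
  { pose proof (derive_lower_bound_abs u m (v x) (v x + k) Hd Hu) as H.
    rewrite Huk in H. replace (v x + k - v x) with k in H by ring.
    rewrite Rabs_div by exact Hk0.
    apply Rmult_le_reg_r with (Rabs k); [now apply Rabs_pos_lt|].
    unfold Rdiv. rewrite Rmult_assoc, Rinv_l by now apply Rabs_no_R0. lra. }
  replace (k / h - / d) with (- (h / k - d) / (h / k * d)) by (field; repeat split; lra).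
  rewrite Rabs_div.
  2:{ apply Rmult_integral_contrapositive_currified; [|lra].
      intros E; rewrite E, Rabs_R0 in Hslope; lra. }
  rewrite Rabs_Ropp, Rabs_mult, (Rabs_pos_eq d) by lra.
  assert (Hmm : m * m <= Rabs (h / k) * d) by (apply Rmult_le_compat; lra).
  assert (0 < m * m) by nra.
  apply Rmult_lt_reg_r with (Rabs (h / k) * d); [lra|].
  unfold Rdiv at 1. rewrite Rmult_assoc, Rinv_l by lra. rewrite Rmult_1_r.
  eapply Rlt_le_trans; [exact Hdel|]. apply Rmult_le_compat_l; lra.
Qed.

(** The chain rule gives [d (v o f) = d f / (u' o (v o f))], whose right-hand side
    is of class [C^n] as soon as [v o f] is: the regularity bootstraps. *)
Lemma class_C_inverse (u v : R -> R) (n : nat) :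
  smooth1 u -> (forall x, Derive u x <> 0) ->
  (forall x, is_derive v x (/ Derive u (v x))) ->
  forall f, class_C n f -> class_C n (fun p => v (f p)).
Proof.
  intros Hu Hu0 Hv.
  assert (Dv : forall x, ex_derive v x) by (intros x; eexists; apply Hv).
  assert (Hc : forall f : R * R -> R, (forall p, continuous f p) ->
    forall p, continuous (fun p => v (f p)) p).
  { intros f Hf p. apply (continuous_comp f v); [apply Hf|].
    apply continuous_of_ex_derive, Dv. }
  induction n as [|n IH]; intros f Hf.
  - split; [|exact I]. apply Hc. now apply (class_C_continuous 0).
  - split; [apply Hc; now apply (class_C_continuous (S n))|].
    pose proof (IH f (class_C_pred _ _ Hf)) as Hvf.
    destruct Hf as (_ & Df & Pf).
    split.
    + intros a p. generalize (Df a p) (Dv (slice a f p (coord a p))).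
      intros H1 H2. destruct a; exact (ex_derive_comp _ _ _ H2 H1).
    + intros a.
      replace (partial a (fun p => v (f p)))
        with (fun p => partial a f p * / Derive u (v (f p))).
      { apply class_C_mult; [apply Pf|]. apply class_C_inv; [intros; apply Hu0|].
        apply (class_C_comp n (Derive u)); [now apply smooth1_Derive | exact Hvf]. }
      apply functional_extensionality; intros p. symmetry. unfold partial.
      rewrite <- (is_derive_unique _ _ _ (Hv (f p))), <- (slice_coord a f p).
      generalize (Df a p) (Dv (slice a f p (coord a p))).
      intros H1 H2. destruct a; exact (Derive_comp _ _ _ H2 H1).
Qed.

(** * Norms of sine waves *)

(** A derivative in [x] multiplies the amplitude by [c] and shifts the phase, one
    in [y] makes the wave vanish. *)
Lemma pderiv_sine (k c th : R) : 0 <= c -> forall (w : list axis) (f : R * R -> R),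
  (forall p, f p = k * sin (c * fst p + th)) ->
  exists k' th', Rabs k' <= Rabs k * Rmax 1 c ^ length w /\
    forall p, pderiv w f p = k' * sin (c * fst p + th').
Proof.
  intros Hc w f Hf.
  assert (Hmax : 1 <= Rmax 1 c /\ c <= Rmax 1 c) by (split; [apply Rmax_l | apply Rmax_r]).
  induction w as [|[] w (k' & th' & Hk & IH)]; simpl.
  - exists k, th. split; [lra | exact Hf].
  - exists (k' * c), (th' + PI / 2). split.
    + rewrite Rabs_mult, (Rabs_pos_eq c) by lra.
      replace (Rabs k * (Rmax 1 c * Rmax 1 c ^ length w))
        with ((Rabs k * Rmax 1 c ^ length w) * Rmax 1 c) by ring.
      apply Rmult_le_compat; auto using Rabs_pos; lra.
    + intros [x y]. simpl.
      rewrite (Derive_ext _ (fun s => k' * sin (c * s + th'))) by (intros; apply IH).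
      apply is_derive_unique, is_derive_sine.
  - exists 0, 0. split.
    + rewrite Rabs_R0. apply Rmult_le_pos; [apply Rabs_pos|].
      apply Rmult_le_pos; [lra|]. apply pow_le; lra.
    + intros [x y]. simpl.
      rewrite (Derive_ext _ (fun _ => k' * sin (c * x + th'))) by (intros; apply IH).
      rewrite Derive_const. ring.
Qed.

(** With [c = 0] and [th = PI / 2] the wave is the constant [k], so that
    translations are covered as well. *)
Lemma Cr_norm_sine (r : nat) (A : R * R -> Prop) (F : R * R -> R * R) (k c th eps : R) :
  0 <= c -> (forall p, F p = (k * sin (c * fst p + th), 0)) ->
  Rabs k * Rmax 1 c ^ r < eps -> Rbar_lt (Cr_norm r A F) eps.
Proof.
  intros Hc HF Heps.
  assert (Hmax : 1 <= Rmax 1 c) by apply Rmax_l.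
  assert (Hbound : forall k0 k1 th0 (w : list axis) (p : R * R), (length w <= r)%nat ->
    Rabs k0 <= Rabs k ->
    Rabs k1 <= Rabs k0 * Rmax 1 c ^ length w ->
    Rabs (k1 * sin (c * fst p + th0)) <= Rabs k * Rmax 1 c ^ r).
  { intros k0 k1 th0 w p Hw H0 H1. rewrite Rabs_mult.
    assert (Hs : Rabs (sin (c * fst p + th0)) <= 1)
      by (apply Rabs_le; apply SIN_bound).
    assert (Hp : Rmax 1 c ^ length w <= Rmax 1 c ^ r) by now apply Rle_pow.
    assert (0 <= Rmax 1 c ^ length w) by (apply pow_le; lra).
    pose proof (Rabs_pos k0). pose proof (Rabs_pos k1).
    pose proof (Rabs_pos (sin (c * fst p + th0))).
    apply Rle_trans with (Rabs k1 * 1); [apply Rmult_le_compat; lra|].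
    rewrite Rmult_1_r. eapply Rle_trans; [exact H1|]. apply Rmult_le_compat; lra. }
  apply Rbar_le_lt_trans with (Finite (Rabs k * Rmax 1 c ^ r)); [|exact Heps].
  apply (proj2 (Lub_Rbar_correct _)).
  intros v (w & p & Hw & _ & [-> | ->]); simpl.
  - destruct (pderiv_sine k c th Hc w (fun q => fst (F q))) as (k1 & th1 & Hk1 & E).
    { intros q; now rewrite HF. }
    rewrite E. now apply (Hbound k k1 th1 w).
  - destruct (pderiv_sine 0 c 0 Hc w (fun q => snd (F q))) as (k1 & th1 & Hk1 & E).
    { intros q; rewrite HF; simpl; ring. }
    rewrite E. apply (Hbound 0 k1 th1 w); [exact Hw| |exact Hk1].
    rewrite Rabs_R0; apply Rabs_pos.
Qed.

(** * The intersection property *)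

Lemma periodic_IZR (f : R -> R) :
  (forall t, f (t + 1) = f t) -> forall (k : Z) t, f (t + IZR k) = f t.
Proof.
  intros Hf. induction k as [|k IH|k IH] using Z.peano_ind; intros t.
  - now rewrite Rplus_0_r.
  - rewrite succ_IZR, <- Rplus_assoc, Hf. apply IH.
  - rewrite <- (Hf (t + _)), <- (IH t), <- Z.sub_1_r, minus_IZR. f_equal; ring.
Qed.

Lemma periodic_extrema (f : R -> R) :
  (forall t, continuous f t) -> (forall t, f (t + 1) = f t) ->
  exists t_min t_max, forall t, f t_min <= f t <= f t_max.
Proof.
  intros Hc Hp.
  assert (Hc' : forall c, 0 <= c <= 1 -> continuity_pt f c)
    by (intros; apply continuity_pt_filterlim, Hc).
  destruct (continuity_ab_min f 0 1 Rle_0_1 Hc') as (t1 & H1 & _).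
  destruct (continuity_ab_maj f 0 1 Rle_0_1 Hc') as (t2 & H2 & _).
  exists t1, t2. intros t.
  rewrite (Rplus_Int_part_frac_part t), Rplus_comm, periodic_IZR by exact Hp.
  pose proof (base_fp t). split; [apply H1 | apply H2]; lra.
Qed.

(** With [xi] inverse to the abscissa [x] along the curve, [tau s] is the parameter
    of the point of the curve that lies above or below the image of the point of
    parameter [s].  The height difference [y s - y (tau s)] is nonnegative where
    [y] is maximal and nonpositive where [y] is minimal, so it vanishes
    somewhere. *)
Lemma intersection_of_height_preserving (F : R * R -> R * R) :
  (forall p, continuous (fun q => fst (F q)) p) -> (forall p, snd (F p) = snd p) ->
  intersection_property F.
Proof.
  intros HFc HFs. exists (1 / 2). split; [lra|].
  intros gamma c (Hclosed & _ & HC1 & _) _ Hclose.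
  set (x := fun t => fst (gamma t)). set (y := fun t => snd (gamma t)).
  assert (Hx : forall t, ex_derive x t) by (intros t; apply HC1).
  assert (Hxc : forall t, continuous x t) by (intros; apply continuous_of_ex_derive, Hx).
  assert (Hyc : forall t, continuous y t)
    by (intros t; apply continuous_of_ex_derive, (HC1 t)).
  destruct (expanding_inverse x (1 / 2)) as (xi & Hxi & _ & Hxid); [lra | exact Hx | |].
  { intros t. destruct (Hclose t) as (_ & _ & H & _). fold x in H.
    apply Rabs_def2 in H. lra. }
  destruct (periodic_extrema y Hyc) as (t1 & t2 & Hext).
  { intros t. apply (proj2 (Hclosed t)). }
  set (tau := fun s => xi (fst (F (gamma s)))).
  assert (Htc : forall s, continuous tau s).
  { intros s. apply (continuous_comp (fun s => fst (F (gamma s))) xi).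
    - apply (continuous_comp gamma (fun q => fst (F q))); [|apply HFc].
      apply continuous_ext with (fun s => (x s, y s)).
      { intros t; unfold x, y; now destruct (gamma t). }
      apply (continuous_comp_2 x y pair); [apply Hxc | apply Hyc|].
      apply continuous_ext with (fun z => z); [now intros [] | apply continuous_id].
    - apply continuous_of_ex_derive. eexists; apply Hxid. }
  destruct (IVT_gen (fun s => y s - y (tau s)) t1 t2 0) as (s & _ & Hs).
  - intros s. apply continuity_pt_filterlim.
    apply (continuous_minus (V := R_NormedModule) y (fun s => y (tau s))); [apply Hyc|].
    apply (continuous_comp tau y); auto.
  - pose proof (Hext (tau t1)). pose proof (Hext (tau t2)).
    split; [eapply Rle_trans; [apply Rmin_l|] | eapply Rle_trans; [|apply Rmax_r]]; lra.
  - exists s, (tau s). split.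
    + exists 0%Z. change (fst (gamma (tau s))) with (x (tau s)).
      unfold tau. rewrite Hxi. ring.
    + rewrite HFs. fold (y s) (y (tau s)). lra.
Qed.

(** * Recurrence of rotations *)

(** Two multiples [n1 rho] and [n2 rho] have close fractional parts, as these
    accumulate in the unit interval; their difference is close to an integer. *)
Lemma integer_multiple_close (rho eps : R) : 0 < eps ->
  exists (n : nat) (k : Z), (1 <= n)%nat /\ Rabs (INR n * rho - IZR k) < eps.
Proof.
  intros Heps.
  destruct (Bolzano_Weierstrass (fun n => frac_part (INR n * rho)) _ (compact_P3 0 1))
    as (l & Hl).
  { intros n. pose proof (base_fp (INR n * rho)). lra. }
  assert (He : 0 < eps / 2) by lra.
  assert (Hn : neighbourhood (disc l (mkposreal _ He)) l)
    by (exists (mkposreal _ He); intros t Ht; exact Ht).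
  destruct (Hl _ O Hn) as (n1 & _ & H1).
  destruct (Hl _ (S n1) Hn) as (n2 & Hle & H2).
  unfold disc in H1, H2; simpl in H1, H2.
  exists (n2 - n1)%nat, (Int_part (INR n2 * rho) - Int_part (INR n1 * rho))%Z.
  split; [lia|].
  rewrite minus_INR, minus_IZR by lia.
  pose proof (Rplus_Int_part_frac_part (INR n1 * rho)).
  pose proof (Rplus_Int_part_frac_part (INR n2 * rho)).
  apply Rabs_def2 in H1. apply Rabs_def2 in H2. apply Rabs_def1; lra.
Qed.

Lemma eqT_trans (x y z : R) : eqT x y -> eqT y z -> eqT x z.
Proof.
  intros (k & ->) (l & ->). exists (l + k)%Z. rewrite plus_IZR; ring.
Qed.

Lemma eqT_sym (x y : R) : eqT x y -> eqT y x.
Proof. intros (k & ->). exists (- k)%Z. rewrite opp_IZR; ring. Qed.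

Lemma eqcyl_trans (p q z : R * R) : eqcyl p q -> eqcyl q z -> eqcyl p z.
Proof.
  intros (H1 & H2) (H3 & H4). split; [eapply eqT_trans; eassumption | congruence].
Qed.

Lemma eqcyl_sym (p q : R * R) : eqcyl p q -> eqcyl q p.
Proof. intros (H1 & H2). split; [now apply eqT_sym | congruence]. Qed.

Lemma closed_curve_IZR (phi : R -> R * R) :
  closed_curve phi -> forall (k : Z) t, eqcyl (phi (t + IZR k)) (phi t).
Proof.
  intros Hphi. induction k as [|k IH|k IH] using Z.peano_ind; intros t.
  - rewrite Rplus_0_r. split; [exists 0%Z; ring | reflexivity].
  - rewrite succ_IZR, <- Rplus_assoc. eapply eqcyl_trans; [apply Hphi | apply IH].
  - apply eqcyl_trans with (phi (t + IZR k)); [|apply IH].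
    replace (t + IZR k) with (t + IZR (Z.pred k) + 1)
      by (rewrite <- Z.sub_1_r, minus_IZR; ring).
    apply eqcyl_sym, Hphi.
Qed.

(** The subsequence of the iterates of [F^q] is needed because the maps at hand
    are understood along multiples of [q]; it is a rotation by [q rho]. *)
Lemma rotation_recurrent (F : R * R -> R * R) (L : R * R -> Prop) (p : R * R)
  (q : nat) (eps : R) :
  cyl_map F -> conj_rotation F L -> L p -> 0 < eps ->
  exists (n : nat) (k : Z), (1 <= n)%nat /\
    Rabs (fst (Nat.iter (n * q) F p) - fst p - IZR k) < eps.
Proof.
  intros HF (phi & rho & Hc & Hclosed & _ & Him & Hconj) Hp Heps.
  destruct (proj1 (Him p) Hp) as (t & Ht).
  assert (Hiter : forall n, eqcyl (Nat.iter n F p) (phi (t + INR n * rho))).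
  { induction n as [|n IH].
    - simpl. rewrite Rmult_0_l, Rplus_0_r. now apply eqcyl_sym.
    - replace (t + INR (S n) * rho) with (t + INR n * rho + rho) by (rewrite S_INR; ring).
      eapply eqcyl_trans; [apply HF, IH | apply Hconj]. }
  assert (Hfst : continuous (fun s => fst (phi s)) t).
  { apply (continuous_comp phi fst); [apply Hc|]. destruct (phi t); apply continuous_fst. }
  destruct (proj1 (filterlim_locally _ _) Hfst (mkposreal _ Heps)) as (del & Hdel).
  destruct (integer_multiple_close (INR q * rho) del (cond_pos del)) as (n & k & Hn & Hk).
  set (s := t + INR (n * q) * rho).
  assert (Hs : eqcyl (Nat.iter (n * q) F p) (phi (s - IZR k))).
  { eapply eqcyl_trans; [apply Hiter|]. fold s.
    replace s with (s - IZR k + IZR k) at 1 by ring. now apply closed_curve_IZR. }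
  assert (Hball : Rabs (fst (phi (s - IZR k)) - fst (phi t)) < eps).
  { apply (Hdel (s - IZR k)). change (Rabs (s - IZR k - t) < del).
    replace (s - IZR k - t) with (INR n * (INR q * rho) - IZR k); [exact Hk|].
    unfold s. rewrite mult_INR. ring. }
  destruct Hs as ((k1 & E1) & _), Ht as ((k2 & E2) & _).
  exists n, (k1 + k2)%Z. split; [exact Hn|].
  rewrite E1. rewrite E2 in Hball. rewrite plus_IZR.
  match goal with |- Rabs ?a < _ => match type of Hball with Rabs ?b < _ =>
    replace a with b by ring end end.
  exact Hball.
Qed.

(** * Height-preserving skew products *)

Definition sheared (g omega : R -> R) (p : R * R) : R * R :=
  (g (fst p) + omega (snd p), snd p).

Lemma eqT_shift (g : R -> R) (s t r : R) :
  (forall x (k : Z), g (x + IZR k) = g x + IZR k) ->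
  eqT s t -> eqT (g s + r) (g t + r).
Proof. intros Hg (k & ->). exists k. rewrite Hg; ring. Qed.

Lemma smooth_map_height_preserving (v : R * R -> R) :
  (forall n, class_C n v) -> smooth_map (fun p => (v p, snd p)).
Proof.
  intros Hv. split; apply smooth2_of_class_C; intros n; simpl; [apply Hv | apply class_C_snd].
Qed.

Lemma continuous_pair (U : UniformSpace) (f g : U -> R) (z : U) :
  continuous f z -> continuous g z -> continuous (fun z => (f z, g z)) z.
Proof.
  intros Hf Hg. apply (continuous_comp_2 f g pair); [exact Hf | exact Hg|].
  apply continuous_ext with (fun z => z); [now intros [] | apply continuous_id].
Qed.

(** The inverse is [(v (x - omega y), y)], with [v] the inverse of [g].  The convex
    combinations of [F] and the identity commute with integer translations in
    the abscissa and provide the homotopy. *)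
Lemma Diff0_sheared (g omega : R -> R) (m : R) :
  smooth1 g -> 0 < m -> (forall x, m <= Derive g x) ->
  (forall x (k : Z), g (x + IZR k) = g x + IZR k) ->
  smooth1 omega -> Diff0 (sheared g omega).
Proof.
  intros Hg Hm Hgm Hgk Ho.
  assert (Hg1 : forall x, ex_derive g x) by (intros; now apply smooth1_ex_derive).
  destruct (expanding_inverse g m Hm Hg1 Hgm) as (v & Hgv & Hvg & Hvd).
  assert (Hvk : forall x (k : Z), v (x + IZR k) = v x + IZR k).
  { intros x k. rewrite <- (Hgv x) at 1. now rewrite <- Hgk, Hvg. }
  assert (Hcyl : forall s, cyl_map (fun p =>
    ((s * fst p + (1 - s) * g (fst p)) + (1 - s) * omega (snd p), snd p))).
  { intros s [x y] [x' y'] [Hx Hy]. simpl in *. subst y'. split; [|reflexivity]. simpl.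
    apply (eqT_shift (fun t => s * t + (1 - s) * g t)); [|exact Hx].
    intros t k. rewrite Hgk. ring. }
  split.
  - split.
    { (* [F] is the convex combination of parameter [0]. *)
      intros p q H. specialize (Hcyl 0 p q H). unfold sheared. simpl in Hcyl.
      rewrite !Rmult_0_l, !Rplus_0_l, !Rminus_0_r, !Rmult_1_l in Hcyl. exact Hcyl. }
    split.
    { apply smooth_map_height_preserving. intros n.
      apply class_C_plus; apply class_C_comp; auto using class_C_fst, class_C_snd. }
    exists (fun p => (v (fst p + (-1) * omega (snd p)), snd p)).
    split; [|split; [|split]].
    + intros [x y] [x' y'] [Hx Hy]. simpl in *. subst y'. split; [|reflexivity]. simpl.
      destruct Hx as (k & ->). exists k. rewrite <- Hvk. f_equal; ring.
    + apply smooth_map_height_preserving. intros n.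
      apply (class_C_inverse g v n Hg); [|exact Hvd|].
      { intros x; specialize (Hgm x); lra. }
      apply class_C_plus; [apply class_C_fst|].
      apply class_C_mult; [apply class_C_const|].
      apply class_C_comp; auto using class_C_snd.
    + intros [x y]. split; [exists 0%Z|reflexivity]. simpl.
      replace (g x + omega y + -1 * omega y) with (g x) by ring. rewrite Hvg; ring.
    + intros [x y]. split; [exists 0%Z|reflexivity]. simpl. rewrite Hgv; ring.
  - exists (fun z => ((fst z * fst (snd z) + (1 - fst z) * g (fst (snd z)))
                      + (1 - fst z) * omega (snd (snd z)), snd (snd z))).
    split; [|split; [|split]].
    + intros z.
      assert (Cs : continuous (fun z : R * (R * R) => fst z) z)
        by (destruct z; apply continuous_fst).
      assert (Cp : continuous (fun z : R * (R * R) => snd z) z)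
        by (destruct z; apply continuous_snd).
      assert (Cx : continuous (fun z : R * (R * R) => fst (snd z)) z).
      { apply (continuous_comp (fun z : R * (R * R) => snd z) fst); [exact Cp|].
        destruct (snd z); apply continuous_fst. }
      assert (Cy : continuous (fun z : R * (R * R) => snd (snd z)) z).
      { apply (continuous_comp (fun z : R * (R * R) => snd z) snd); [exact Cp|].
        destruct (snd z); apply continuous_snd. }
      assert (Cm : continuous (fun z : R * (R * R) => 1 - fst z) z)
        by (apply (continuous_minus (V := R_NormedModule));
            [apply continuous_const | exact Cs]).
      apply continuous_pair; [|exact Cy].
      apply (continuous_plus (V := R_NormedModule)).
      * apply (continuous_plus (V := R_NormedModule));
          apply (continuous_mult (K := R_AbsRing)); auto.
        apply (continuous_comp (fun z : R * (R * R) => fst (snd z)) g); [exact Cx|].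
        now apply smooth1_continuous.
      * apply (continuous_mult (K := R_AbsRing)); [exact Cm|].
        apply (continuous_comp (fun z : R * (R * R) => snd (snd z)) omega); [exact Cy|].
        now apply smooth1_continuous.
    + intros s _. exact (Hcyl s).
    + intros [x y]. split; [exists 0%Z | reflexivity]. simpl. ring.
    + intros [x y]. split; [exists 0%Z | reflexivity]. simpl. ring.
Qed.

(** At height [y0], the iterate of order [n q] is [g] iterated [n q] times, up to
    the integer [n m].  The iterates of [x0] under [g] stay in [[g x0, beta]],
    thus at distance at least [eps] from [x0] and from all its integer
    translates. *)
Lemma sheared_not_integrable (g omega : R -> R) (q : nat) (m : Z) (a b y0 x0 beta : R) :
  cyl_map (sheared g omega) ->
  (1 <= q)%nat -> (forall x (j : Z), g (x + IZR j / INR q) = g x + IZR j / INR q) ->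
  a < y0 < b -> omega y0 = IZR m / INR q ->
  beta - x0 < 1 -> x0 < g x0 -> g x0 <= beta ->
  (forall x, x0 <= x <= beta -> x <= g x <= beta) ->
  ~ integrable_in (sheared g omega) (strip (fun y => a < y < b)).
Proof.
  intros HF Hq Hgq Hy0 Hom Hlen Hx0 Hgb Hinv (U & leaf & _ & HAU & (HU & _) & Hleaf).
  destruct (proj1 (HU (x0, y0)) (HAU (x0, y0) Hy0)) as (L & HL & HpL).
  destruct (Hleaf L HL) as (_ & _ & Hrot).
  assert (HqR : 1 <= INR q) by (apply (le_INR 1); exact Hq).
  assert (Hiter : forall n, Nat.iter n (sheared g omega) (x0, y0) =
    (Nat.iter n g x0 + IZR (Z.of_nat n * m) / INR q, y0)).
  { induction n as [|n IH].
    - simpl. f_equal. field. lra.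
    - change (Nat.iter (S n) (sheared g omega) (x0, y0))
        with (sheared g omega (Nat.iter n (sheared g omega) (x0, y0))).
      rewrite IH. unfold sheared; simpl fst; simpl snd. rewrite Hgq, Hom.
      rewrite Nat2Z.inj_succ, Z.mul_succ_l, plus_IZR. f_equal. simpl. field. lra. }
  assert (Horb : forall n, g x0 <= Nat.iter (S n) g x0 <= beta).
  { induction n as [|n IH]; [simpl; lra|].
    change (Nat.iter (S (S n)) g x0) with (g (Nat.iter (S n) g x0)).
    pose proof (Hinv (Nat.iter (S n) g x0)). lra. }
  set (eps := Rmin (g x0 - x0) (1 - (beta - x0))).
  assert (Heps : 0 < eps) by (apply Rmin_pos; lra).
  assert (Heps1 : eps <= g x0 - x0) by apply Rmin_l.
  assert (Heps2 : eps <= 1 - (beta - x0)) by apply Rmin_r.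
  destruct (rotation_recurrent _ L (x0, y0) q eps HF Hrot HpL Heps) as (n & k & Hn & Hk).
  rewrite Hiter in Hk. simpl fst in Hk.
  set (j := (k - Z.of_nat n * m)%Z).
  assert (Hj : IZR (Z.of_nat (n * q) * m) / INR q - IZR k = - IZR j).
  { unfold j. rewrite Nat2Z.inj_mul, minus_IZR, !mult_IZR, <- !INR_IZR_INZ. field. lra. }
  destruct (n * q)%nat as [|N] eqn:EN; [nia|].
  pose proof (Horb N) as HN. apply Rabs_def2 in Hk.
  destruct (Z_le_gt_dec j 0) as [Hj0|Hj0].
  - apply IZR_le in Hj0. lra.
  - assert (H1 : (1 <= j)%Z) by lia. apply IZR_le in H1. lra.
Qed.

(** * Choice of the parameters *)

Lemma sin_2PI_IZR (t : R) (k : Z) : sin (2 * PI * (t + IZR k)) = sin (2 * PI * t).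
Proof.
  revert k t. apply (periodic_IZR (fun t => sin (2 * PI * t))).
  intros t. rewrite <- (sin_period (2 * PI * t) 1). f_equal. simpl. ring.
Qed.

Lemma exists_fraction_between (q : nat) (x : R) : (1 <= q)%nat ->
  exists m : Z, x < IZR m / INR q <= x + / INR q.
Proof.
  intros Hq. assert (HqR : 1 <= INR q) by (apply (le_INR 1); exact Hq).
  destruct (archimed (INR q * x)) as [H1 H2].
  exists (up (INR q * x)). split.
  - apply Rmult_lt_reg_r with (INR q); [lra|]. unfold Rdiv.
    rewrite Rmult_assoc, Rinv_l by lra. lra.
  - apply Rmult_le_reg_r with (INR q); [lra|]. unfold Rdiv.
    rewrite Rmult_plus_distr_r, Rmult_assoc, Rinv_l by lra. lra.
Qed.

(** An interval of values longer than [1 / q] contains a fraction of denominator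
    [q], whatever the interval: this lets the same [q] serve for [alpha] and for
    [omega]. *)
Lemma exists_fraction_value (f : R -> R) (a b : R) :
  (forall t, continuous f t) -> a < b -> f a <> f b ->
  exists N : R, forall q : nat, N < INR q ->
    exists (m : Z) (y0 : R), a < y0 < b /\ f y0 = IZR m / INR q.
Proof.
  intros Hc Hab Hne.
  set (lo := Rmin (f a) (f b)). set (hi := Rmax (f a) (f b)).
  assert (Hlh : 0 < hi - lo) by (unfold hi, lo, Rmax, Rmin; destruct Rle_dec; lra).
  assert (Hi : 0 < / (hi - lo)) by now apply Rinv_0_lt_compat.
  exists (/ (hi - lo)). intros q Hq.
  assert (Hq1 : (1 <= q)%nat) by (apply INR_lt; simpl; lra).
  destruct (exists_fraction_between q lo Hq1) as (m & Hm1 & Hm2).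
  assert (Hqi : / INR q < hi - lo).
  { rewrite <- (Rinv_inv (hi - lo)). apply Rinv_lt_contravar; [nra | exact Hq]. }
  destruct (IVT_gen f a b (IZR m / INR q)) as (y0 & Hy & Ey).
  - intros t. apply continuity_pt_filterlim, Hc.
  - fold lo hi. lra.
  - exists m, y0. split; [|exact Ey].
    rewrite Rmin_left, Rmax_right in Hy by lra.
    assert (f y0 <> f a) by (unfold lo, hi, Rmax, Rmin in *; destruct Rle_dec; lra).
    assert (f y0 <> f b) by (unfold lo, hi, Rmax, Rmin in *; destruct Rle_dec; lra).
    split; (apply Rnot_le_lt; intros Hle;
      match goal with H : f y0 <> f ?e |- _ => apply H; f_equal; lra end).
Qed.

Theorem proposition2 :
  forall (omega : R -> R), smooth_diffeo_R omega ->
  forall (alpha a b delta : R), a < b -> 0 < delta ->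
  forall (r : nat) (eps : R), 0 < eps ->
  exists F K : R * R -> R * R,
    Diff0 F /\ Diff0 K /\ commuting F K /\
    intersection_property F /\
    Rbar_lt
      (Cr_norm r (strip (nbhd_set (fun y => a < y < b) delta))
               (diff_map F (F0 omega)))
      eps /\
    Rbar_lt
      (Cr_norm r (strip (nbhd_set (fun y => a < y < b) delta))
               (diff_map K (Talpha alpha)))
      eps /\
    (~ integrable_in F (strip (fun y => a < y < b)) \/
     ~ integrable_in K (strip (fun y => a < y < b))).
Proof.
  intros omega (Ho & omega' & _ & Hinv & _) alpha a b delta Hab _ r eps Heps.
  assert (Hoab : omega a <> omega b).
  { intros E. pose proof (Hinv a) as H. rewrite E, Hinv in H. lra. }
  destruct (exists_fraction_value omega a b) as (N & HN); [|exact Hab|exact Hoab|].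
  { intros; now apply smooth1_continuous. }
  destruct (INR_unbounded (Rmax 1 (Rmax N (/ eps)))) as (q & Hq).
  assert (Hq1 : 1 < INR q) by (eapply Rle_lt_trans; [apply Rmax_l | exact Hq]).
  assert (Hq2 : Rmax N (/ eps) < INR q) by (eapply Rle_lt_trans; [apply Rmax_r | exact Hq]).
  assert (HqN : N < INR q) by (eapply Rle_lt_trans; [apply Rmax_l | exact Hq2]).
  assert (Hqe : / eps < INR q) by (eapply Rle_lt_trans; [apply Rmax_r | exact Hq2]).
  assert (Hqn : (1 <= q)%nat) by (apply INR_le; simpl; lra).
  destruct (HN q HqN) as (m & y0 & Hy0 & Em).
  destruct (exists_fraction_between q alpha Hqn) as (l & Hl1 & Hl2).
  assert (Hie : / INR q < eps).
  { rewrite <- (Rinv_inv eps). apply Rinv_lt_contravar; [|exact Hqe].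
    apply Rmult_lt_0_compat; [now apply Rinv_0_lt_compat | lra]. }
  set (c := 2 * PI * INR q).
  assert (Hc : 1 <= c) by (pose proof PI2_1; unfold c; nra).
  assert (Hcr : 0 < c ^ r) by (apply pow_lt; lra).
  (* The first bound makes [g' >= 1 / 2], the second one makes the norm of the
     perturbation at most [eps / 2]. *)
  set (k := Rmin (/ (2 * c)) (eps / 2 * / c ^ r)).
  assert (Hk0 : 0 < k).
  { apply Rmin_pos; [apply Rinv_0_lt_compat; lra|].
    apply Rmult_lt_0_compat; [lra | now apply Rinv_0_lt_compat]. }
  assert (Hkc : k * c <= 1 / 2).
  { replace (1 / 2) with (/ (2 * c) * c) by (field; lra).
    apply Rmult_le_compat_r; [lra | apply Rmin_l]. }
  assert (Hkr : k * c ^ r <= eps / 2).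
  { replace (eps / 2) with (eps / 2 * / c ^ r * c ^ r) by (field; lra).
    apply Rmult_le_compat_r; [lra | apply Rmin_r]. }
  set (g := fun x => x + k * sin (c * x + 0)).
  assert (Hg : smooth1 g) by (apply smooth1_plus; [apply smooth1_id | apply smooth1_sine]).
  assert (Hgd : forall x, 1 / 2 <= Derive g x).
  { intros x.
    replace (Derive g x) with (1 + k * c * sin (c * x + (0 + PI / 2))).
    2:{ symmetry. apply is_derive_unique.
        apply (is_derive_plus (V := R_NormedModule) (fun t => t));
          [apply (is_derive_id (K := R_AbsRing)) | apply is_derive_sine]. }
    pose proof (SIN_bound (c * x + (0 + PI / 2))) as [Hs _].
    pose proof (Rmult_le_pos k c). nra. }
  assert (Hgq : forall x (j : Z), g (x + IZR j / INR q) = g x + IZR j / INR q).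
  { intros x j. unfold g.
    replace (c * (x + IZR j / INR q) + 0) with (2 * PI * (INR q * x + IZR j))
      by (unfold c; field; lra).
    rewrite sin_2PI_IZR.
    replace (2 * PI * (INR q * x)) with (c * x + 0) by (unfold c; ring). ring. }
  assert (Hg1 : forall x (j : Z), g (x + IZR j) = g x + IZR j).
  { intros x j. specialize (Hgq x (j * Z.of_nat q)%Z).
    rewrite mult_IZR, <- INR_IZR_INZ in Hgq.
    replace (IZR j * INR q / INR q) with (IZR j) in Hgq by (field; lra). exact Hgq. }
  assert (HDF : Diff0 (sheared g omega)) by (apply (Diff0_sheared g omega (1 / 2)); auto; lra).
  set (tr := fun x => x + IZR l / INR q).
  assert (Htr : smooth1 tr) by (apply smooth1_plus; [apply smooth1_id | apply smooth1_const]).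
  exists (sheared g omega), (sheared tr (fun _ => 0)).
  split; [exact HDF|]. split.
  { apply (Diff0_sheared tr (fun _ => 0) 1); [exact Htr | lra | | | apply smooth1_const].
    - intros x. unfold tr. rewrite Derive_plus, Derive_id, Derive_const.
      + lra.
      + apply ex_derive_id.
      + apply ex_derive_const.
    - intros x j. unfold tr. ring. }
  split.
  { intros [x y]. split; [exists 0%Z | reflexivity]. unfold sheared, tr; simpl.
    rewrite Rplus_0_r, Hgq. ring. }
  split.
  { apply intersection_of_height_preserving; [|reflexivity].
    intros p. apply (class_C_continuous 0 (fun q => g (fst q) + omega (snd q))).
    apply class_C_plus; apply class_C_comp; auto using class_C_fst, class_C_snd. }
  split.
  { apply Cr_norm_sine with (k := k) (c := c) (th := 0); [lra| |].
    - intros [x y]. unfold diff_map, sheared, F0, g; simpl. f_equal; ring.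
    - rewrite Rmax_right, Rabs_pos_eq by lra. lra. }
  split.
  { apply Cr_norm_sine with (k := IZR l / INR q - alpha) (c := 0) (th := PI / 2); [lra| |].
    - intros [x y]. unfold diff_map, sheared, Talpha, tr; simpl.
      rewrite Rmult_0_l, Rplus_0_l, sin_PI2. f_equal; ring.
    - rewrite Rmax_left, pow1, Rabs_pos_eq by lra. lra. }
  left.
  (* [c * beta = PI]: [beta] is the first positive fixed point of [g], attracting
     the orbit of [beta / 2], where the push by [g] is largest. *)
  set (beta := / (2 * INR q)).
  assert (Hbeta : 0 < beta) by (apply Rinv_0_lt_compat; lra).
  assert (Hbeta1 : beta < 1) by (rewrite <- Rinv_1; apply Rinv_lt_contravar; lra).
  assert (Hcb : c * beta = PI) by (unfold c, beta; field; lra).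
  assert (Hgb : g beta = beta) by (unfold g; rewrite Hcb, Rplus_0_r, sin_PI; ring).
  assert (Hrange : forall x, 0 <= x <= beta -> x <= g x <= beta).
  { intros x Hx. split.
    - unfold g. rewrite Rplus_0_r.
      assert (0 <= sin (c * x)) by (apply sin_ge_0; nra). nra.
    - pose proof (derive_lower_bound g (1 / 2) x beta) as H.
      rewrite Hgb in H. specialize (H (fun t => smooth1_ex_derive g t Hg) Hgd). lra. }
  apply (sheared_not_integrable g omega q m a b y0 (beta / 2) beta); auto; try lra.
  - apply (proj1 (proj1 HDF)).
  - unfold g. replace (c * (beta / 2) + 0) with (PI / 2) by (rewrite <- Hcb; field).
    rewrite sin_PI2. lra.
  - apply Hrange. lra.
  - intros x Hx. apply Hrange. lra.
Qed.
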